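(* Let $GF(q)$ be a finite field of order $q=ef+1$, where $e\in\{3,4,6,8\}$, and write $q=p^{2m}$ with $p$ prime. Let $I\subset\{0,1,\ldots,e-1\}$ with $|I|=u$, $2\le u\le e-1$, and $\mathcal{D}'=\{C_i^e\}_{i\in I}$. Set $\eta=\frac{(-p)^m-1}{e}$. If $C_0^e$ is a partial difference set (its parameters then being $(q,\frac{q-1}{e},\eta^2-(e-3)\eta-1,\eta^2+\eta)$), then $\mathcal{D}'$ is both a proper $(q,u,\frac{q-1}{e},u\eta^2+(u+2-e)\eta-1,u(\eta^2+\eta))$-disjoint partial difference family and a proper $(q,u,\frac{q-1}{e},u(u-1)\eta^2+2(u-1)\eta,u(u-1)\eta^2)$-external partial difference family.
   Context: $G=(GF(q),+)$, $G^*=G\setminus\{0\}$; $\alpha$ is a primitive element and $C_i^e=\alpha^i\langle\alpha^e\rangle$ ($0\le i\le e-1$). $\Delta(D)$ is the multiset $\{x-y:x,y\in D,x\neq y\}$, $\Delta(D_1,D_2)$ the multiset $\{x-y:x\in D_1,y\in D_2\}$, and $\lambda A$ is $\lambda$ copies of each element of $A$. $P$ is a $(q,k,\lambda,\mu)$-partial difference set if $|P|=k$ and $\Delta(P)=\lambda P+\mu(G^*\setminus P)$. A family $\{D_1,\dots,D_m\}$ of disjoint $k$-subsets of $G^*$ with union $S$ is a $(q,m,k,\lambda,\mu)$-disjoint partial difference family if $\bigcup_i\Delta(D_i)=\lambda S+\mu(G^*\setminus S)$, and a $(q,m,k,\lambda,\mu)$-external partial difference family if $\bigcup_{i\neq j}\Delta(D_i,D_j)=\lambda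 S+\mu(G^*\setminus S)$; proper means $\lambda\neq\mu$.
   Formalization: The hypothesis f > 1 is added: for f = 1 the claim fails, namely q = 4, e = 3 (the disjoint family has λ = μ = 0, so is not proper) and q = 9, e = 8 (η = −1/2, the stated parameters are not integers). *)

(* Defs.v *)
From HB Require Import structures.
From mathcomp Require Import all_boot all_order all_algebra all_fingroup all_field.

Set Implicit Arguments.
Unset Strict Implicit.
Unset Printing Implicit Defensive.

Import GRing.Theory.
Local Open Scope ring_scope.

(* A multiset on G is its multiplicity function {ffun G -> nat}; sums of
   multisets (the unions of the multisets of differences) are pointwise sums. *)
Section Differences.
Variable G : finZmodType.
Implicit Types (A B P : {set G}) (D : {set {set G}}).

Definition Delta A : {ffun G -> nat} :=
  [ffun d => #|[set z in setX A A | (z.1 != z.2) && (z.1 - z.2 == d)]|].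

Definition Delta2 A B : {ffun G -> nat} :=
  [ffun d => #|[set z in setX A B | z.1 - z.2 == d]|].

Definition copies (l : nat) A : {ffun G -> nat} :=
  [ffun d => if d \in A then l else 0%N].

Definition Gstar : {set G} := [set~ 0].

(* The parameters lambda and mu are natural numbers; they are typed in rat
   because the formulas giving them involve possibly negative quantities. *)
Definition balanced (M : {ffun G -> nat}) A (lambda mu : rat) : Prop :=
  exists l m : nat,
    [/\ lambda = l%:R, mu = m%:R & M = copies l A + copies m (Gstar :\: A)].

Definition partial_difference_set (q k : nat) (lambda mu : rat) P : Prop :=
  [/\ #|G| = q, #|P| = k & balanced (Delta P) P lambda mu].

Definition disjoint_subsets_family (q m k : nat) D : Prop :=
  [/\ #|G| = q, #|D| = m, trivIset D &
      forall A, A \in D -> A \subset Gstar /\ #|A| = k].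

Definition disjoint_pdf (q m k : nat) (lambda mu : rat) D : Prop :=
  disjoint_subsets_family q m k D /\
  balanced (\sum_(A in D) Delta A) (cover D) lambda mu.

Definition external_pdf (q m k : nat) (lambda mu : rat) D : Prop :=
  disjoint_subsets_family q m k D /\
  balanced (\sum_(A in D) \sum_(B in D | A != B) Delta2 A B) (cover D)
           lambda mu.

Definition proper_disjoint_pdf q m k lambda mu D : Prop :=
  disjoint_pdf q m k lambda mu D /\ lambda != mu.

Definition proper_external_pdf q m k lambda mu D : Prop :=
  external_pdf q m k lambda mu D /\ lambda != mu.

End Differences.

(* alpha ^ i * <alpha ^ e>; exponents below #|F| exhaust <alpha ^ e>. *)
Definition cyclotomic_class (F : finFieldType) (alpha : F) (e i : nat) :
    {set F} :=
  [set alpha ^+ i * (alpha ^+ e) ^+ (j : nat) | j : 'I_#|F|].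

(* Main.v *)
Require Import Defs.
From HB Require Import structures.
From mathcomp Require Import all_boot all_order all_algebra all_fingroup all_field.
From mathcomp Require Import all_character ring zify.

Set Implicit Arguments.
Unset Strict Implicit.
Unset Printing Implicit Defensive.

Import Order.TTheory GRing.Theory Num.Theory.
Local Open Scope ring_scope.

(** Write f = (q-1)/e, and let T(c) be the Gaussian period of [C_0] twisted by c.
    If -1 lies in [C_0], the PDS equation makes every T(c), c <> 0, a root of one
    integer quadratic; as the e periods sum to -1, counting how often each root
    occurs gives a Diophantine equation which for e in {3,4,6,8} forces
    eps p^m = 1 mod e and all periods but one equal to (eps p^m - 1)/e, with
    eps = 1 or -1.  The sign is (-1)^m unless p = 1 mod e; then comparing the
    power sums of x - y (x, y in [C_0]) with exponents f and 2f shows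
    that p divides binomial(2f, f), whereas there is no carry in f + f in base p.
    If -1 is not in [C_0], then e = 8, f is odd and lambda = mu; the invariance of
    the periods under Frobenius and their autocorrelations leave only q = 9.
    Finally, since all periods but one equal eta, the class sums [C_i - eta] are
    pairwise orthogonal at every nontrivial character, and Fourier inversion yields
    all the cross differences, hence both families. *)

(** * Diophantine equations for the period values, and a binomial coefficient modulo p *)

(** Squares have even valuation at r, so equality would force the valuations of A and B to have the
    same parity. *)
Lemma int_squares_ratio r A B (w s : int) :
  s != 0 -> odd (logn r A + logn r B) -> (0 < A)%N -> (0 < B)%N ->
  A%:R * w ^+ 2 = B%:R * s ^+ 2 -> False.
Proof.
move=> s0 AB A0 B0 /(congr1 absz); rewrite !expr2 !abszM !natz !absz_nat => E.
have sp : (0 < `|s|)%N by rewrite absz_gt0.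
have wp : (0 < `|w|)%N.
  by rewrite lt0n; apply: contra_eq_neq E => ->; rewrite !muln0 eq_sym -lt0n !muln_gt0 B0 sp.
move: AB; have := congr1 (logn r) E.
rewrite !lognM ?muln_gt0 ?wp ?sp // => /(congr1 odd).
by rewrite !oddD !addbb !addbF => ->; rewrite addbb.
Qed.

(* [w = -n delta] with [n = 2 a - e], where [delta] is the difference of the two
   periods and [a] the multiplicity of the larger one. *)
Lemma multiplicity_eq (e a : nat) (w s : int) :
  e \in [:: 3; 4; 6; 8]%N -> (a <= e)%N -> s != 0 -> w != 0 ->
  e%:R ^+ 2 * w ^+ 2 =
    (2%:R * a%:R - e%:R) ^+ 2 * (w ^+ 2 + 4%:R * s ^+ 2 * (e%:R - 1)) ->
  w ^+ 2 = ((e%:R - 2%:R) * s) ^+ 2.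
Proof.
move=> he ha s0 w0 E.
have W : 0 < w ^+ 2 by rewrite lt_neqAle eq_sym sqrf_eq0 w0 sqr_ge0.
have S : 0 < s ^+ 2 by rewrite lt_neqAle eq_sym sqrf_eq0 s0 sqr_ge0.
have no r A B : odd (logn r A + logn r B) -> (0 < A)%N -> (0 < B)%N ->
  A%:R * w ^+ 2 = B%:R * s ^+ 2 -> False by exact: int_squares_ratio.
(* With n = 2a - e the equation reads (e^2 - n^2) w^2 = 4(e - 1) n^2 s^2, and the claim is the case
   |n| = e - 2. The other cases to exclude are 2 w^2 = 5 s^2 (e = 6, |n| = 2), 3 w^2 = 28 s^2 (e =
   8, |n| = 4) and 15 w^2 = 28 s^2 (e = 8, |n| = 2); n = 0 and |n| = e contradict w, s nonzero. *)
have n1 := no 2 2%N 5%N isT isT isT.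
have n2 := no 3 3%N 28%N isT isT isT.
have n3 := no 3 15%N 28%N isT isT isT.
rewrite exprMn.
move: (w ^+ 2) (s ^+ 2) W S E n1 n2 n3 => {no w0 s0} W S W0 S0 E n1 n2 n3.
move: he; rewrite !inE => /or4P[] /eqP ee; subst e;
  do 9?[case: a ha E => [|a] ha E]; rewrite ?expr2 in E *; try lia.
Qed.

(** Write y = ek + r. Modulo e, r^2 vanishes, which leaves r = 0, or r = e/2 when e is 4 or 8. In
    the latter case y(y + e) is e^2/4 times an odd number, hence not a multiple of e^2. *)
Lemma dvd_of_square_eq (e : nat) (y mu : int) :
  e \in [:: 3; 4; 6; 8]%N -> e%:R ^+ 2 * mu = y * (y + e%:R) ->
  exists z, y = e%:R * z.
Proof.
move=> he E; exists (y %/ e)%Z.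
have := divz_eq y e; have := modz_ge0 y (_ : e%:Z != 0); have := ltz_mod y (_ : e%:Z != 0).
have e0 : e%:Z != 0 by move: he; rewrite !inE => /or4P[] /eqP->.
move=> /(_ e0) + /(_ e0); move: (y %/ e)%Z (y %% e)%Z => k r lt_r r_ge yE.
suff r0 : r = 0 by rewrite yE r0 addr0 mulrC natz.
rewrite {}yE in E; have {}E : e%:R ^+ 2 * mu = e%:R ^+ 2 * (k * k + k) + e%:R * (2%:R * k + 1) * r + r * r :> int.
  by rewrite E -natz; ring.
move: (k * k) E => K E; move: he; rewrite !inE => /or4P[] /eqP ee; subst e;
  (have : r \in [:: 0; 1; 2; 3; 4; 5; 6; 7] by rewrite !inE; lia);
  rewrite !inE !orbA; do 7?[case/orP]; move/eqP=> r0; subst r; rewrite ?expr2 in E *; lia.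
Qed.

(** Here s stands for p^m and z for the value shared by all periods but one. The multiplicity
    equation gives w = e(l - mu) + 2 up to sign; eliminating l then yields e^2 mu = y(y + e) with y
    = eps s - 1, so e divides y. *)
Lemma exists_period_sign (e a s f l mu : nat) :
  e \in [:: 3; 4; 6; 8]%N -> (a <= e)%N -> (s * s = e * f + 1)%N ->
  (f + mu = 1 + l + e * mu)%N ->
  (e%:R * (l%:R - mu%:R) + 2%:R) ^+ 2 =
    (2%:R * a%:R - e%:R) ^+ 2 *
    ((l%:R - mu%:R) ^+ 2 + 4%:R * (f%:R - mu%:R)) :> int ->
  exists eps z : int, [/\ eps = 1 \/ eps = -1, eps * s%:R - 1 = e%:R * z &
    e%:R * (l%:R - mu%:R) + 2%:R = - ((e%:R - 2%:R) * (eps * s%:R))].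
Proof.
move=> he ha hs hf E.
have hsZ : s%:R * s%:R = e%:R * f%:R + 1 :> int by rewrite -!natrM hs natrD natrM.
have hfZ : f%:R + mu%:R = 1 + l%:R + e%:R * mu%:R :> int.
  by rewrite -natrD hf !natrD natrM.
have lE : l%:R = f%:R + mu%:R - 1 - e%:R * mu%:R :> int by rewrite hfZ; ring.
have s0 : (s%:R : int) != 0 by rewrite pnatr_eq0; apply/eqP => s0; rewrite s0 addn1 in hs.
set w := e%:R * _ + _ in E *.
have w0 : w != 0.
  rewrite /w natz; apply/eqP => w0; move: he; rewrite !inE => /or4P[] /eqP ee; subst e; lia.
have wE : w = s%:R * s%:R + 1 - e%:R - e%:R * (e%:R * mu%:R).
  by rewrite /w lE hsZ; ring.
have DE : e%:R ^+ 2 * ((l%:R - mu%:R) ^+ 2 + 4%:R * (f%:R - mu%:R)) =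
    w ^+ 2 + 4%:R * s%:R ^+ 2 * (e%:R - 1) :> int.
  by rewrite [s%:R ^+ 2]expr2 hsZ /w lE; ring.
have /eqP : w ^+ 2 = ((e%:R - 2%:R) * s%:R) ^+ 2.
  apply: (multiplicity_eq he ha s0 w0).
  by rewrite [in LHS]E mulrCA DE.
have e0 : e%:R != 0 :> int by rewrite pnatr_eq0; move: he; rewrite !inE => /or4P[] /eqP->.
have fin (eps : int) : eps = 1 \/ eps = -1 -> w = - ((e%:R - 2%:R) * (eps * s%:R)) ->
    exists eps z : int, [/\ eps = 1 \/ eps = -1, eps * s%:R - 1 = e%:R * z &
    w = - ((e%:R - 2%:R) * (eps * s%:R))].
  move=> heps hw; have eps2 : eps * eps = 1 by case: heps => ->.
  have [z yE] : exists z, eps * s%:R - 1 = e%:R * z.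
    apply: (dvd_of_square_eq (mu := mu%:R) he).
    have -> : e%:R ^+ 2 * mu%:R = s%:R * s%:R + 1 - e%:R - w by rewrite wE; ring.
    have -> : s%:R * s%:R = (eps * s%:R) * (eps * s%:R) by rewrite mulrACA eps2 mul1r.
    by rewrite hw; ring.
  by exists eps, z.
rewrite eqf_sqr => /orP[] /eqP hw; [apply: (fin (-1)); first by right|apply: (fin 1); first by left];
  rewrite hw; ring.
Qed.

(** The unit groups modulo 3, 4, 6 and 8 all have exponent 2. *)
Lemma sqr_mod_unit (e p : nat) :
  e \in [:: 3; 4; 6; 8]%N -> coprime p e -> (p ^ 2 = 1 %[mod e])%N.
Proof.
move=> he; rewrite -modnXm -coprime_modl.
have : (p %% e < e)%N by rewrite ltn_mod; move: he; rewrite !inE => /or4P[] /eqP->.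
by move: he (p %% e)%N; rewrite !inE => /or4P[] /eqP-> r; do 8?[case: r => [|r] //].
Qed.

(** Modulo e, p^m is p for odd m and 1 for even m, while it also equals eps. For odd m and eps = 1
    this says p = 1; for even m and eps = -1 it would make e divide 2. *)
Lemma sign_exponent (e p m f : nat) (eps z : int) :
  e \in [:: 3; 4; 6; 8]%N -> prime p -> (0 < f)%N ->
  (p ^ (2 * m) = e * f + 1)%N -> eps = 1 \/ eps = -1 ->
  eps * (p ^ m)%:R - 1 = e%:R * z ->
  eps = (-1) ^+ m \/ p = 1 %[mod e].
Proof.
move=> he pr_p f0 hq heps hz.
have e_gt2 : (2 < e)%N by move: he; rewrite !inE => /or4P[] /eqP->.
have m0 : (0 < m)%N.
  rewrite lt0n; apply: contra_eq_neq hq => ->; rewrite muln0 expn0.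
  by rewrite addn1 eqSS eq_sym -lt0n muln_gt0 f0 andbT (ltn_trans _ e_gt2).
have cop : coprime p e.
  rewrite prime_coprime //; apply/negP => pe.
  have : (p %| p ^ (2 * m))%N by rewrite dvdn_exp ?muln_gt0.
  by rewrite hq dvdn_addr ?dvdn_mulr // Euclid_dvd1.
have pm : (p ^ m = p ^ odd m %[mod e])%N.
  rewrite -{1}(odd_double_half m) -mul2n expnD expnM -modnMmr -modnXm.
  by rewrite (sqr_mod_unit he cop) modnXm exp1n modnMmr muln1.
have pm0 : (0 < p ^ m)%N by rewrite expn_gt0 prime_gt0.
rewrite -signr_odd; case: heps hz => ->; rewrite ?natz; case: (odd m) pm => pm hz;
  try by left.
  right; rewrite -pm; case: z hz => k hz.
    have -> : (p ^ m = k * e + 1)%N by nia.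
    by rewrite modnMDl.
  by exfalso; nia.
have := divn_eq (p ^ m) e; rewrite pm expn0 modn_small ?(ltnW e_gt2) //.
move: (p ^ m %/ e)%N => K; move: (p ^ m)%N hz => P hz PE; exfalso.
have : 2%:Z = e%:Z * (- z - K%:Z).
 rewrite mulrBr mulrN -hz PE PoszD PoszM; lia.
move/(congr1 absz); rewrite abszM !absz_nat => E2.
have : (e %| 2)%N by rewrite E2 dvdn_mulr.
by rewrite gtnNdvd.
Qed.

(** By Legendre's formula the valuation of binomial(2f, f) is the sum over k of floor(2f/p^k) - 2
    floor(f/p^k), and each of these terms is 0. *)
Lemma prime_ndvd_bin_repunit (e p n f : nat) :
  (2 < e)%N -> prime p -> p = 1 %[mod e] -> (p ^ n = e * f + 1)%N ->
  ~~ (p %| 'C(f * 2, f))%N.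
Proof.
move=> e2 pr_p p1 hf.
have e0 : (0 < e)%N by apply: ltn_trans e2.
have pk k : exists g, (p ^ k = e * g + 1)%N.
  exists (p ^ k %/ e)%N; rewrite {1}(divn_eq (p ^ k) e) mulnC; congr (_ + _)%N.
  by rewrite -modnXm p1 modnXm exp1n modn_small // ltnW.
(* The base-p digits of f are all (p-1)/e, so adding f to itself has no carry. *)
have dbl k : (f * 2 %/ p ^ k = f %/ p ^ k * 2)%N.
  have pk0 : (0 < p ^ k)%N by rewrite expn_gt0 prime_gt0.
  suff [h [g [fE g2]]] : exists h g, f = (h * p ^ k + g)%N /\ (g * 2 < p ^ k)%N.
    rewrite fE mulnDl -mulnA (mulnC (p ^ k)%N) mulnA !divnMDl // (divn_small g2).
    by rewrite divn_small ?addn0 // (leq_ltn_trans _ g2) // leq_pmulr.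
  have [nk|kn] := leqP n k.
    exists 0%N, f; split=> //; apply: leq_trans (_ : p ^ n <= _)%N; last first.
      by rewrite leq_exp2l ?prime_gt1.
    by rewrite hf addn1 ltnS mulnC leq_mul2r ltnW ?orbT.
  (* Here g = (p^k - 1)/e and h = (p^(n-k) - 1)/e, so that f = h p^k + g, and 2g < p^k because e >
     2. *)
  have [g gE] := pk k; have [h hE] := pk (n - k)%N.
  exists h, g; split; last by rewrite gE addn1 ltnS mulnC leq_mul2r ltnW ?orbT.
  apply/eqP; rewrite -(eqn_pmul2l e0) -(eqn_add2r 1) -hf -(subnK (ltnW kn)) expnD.
  by rewrite hE; apply/eqP; rewrite gE; nia.
(* Legendre's formula, with zero terms appended so that the sums for f and 2f have the same
   range. *)
have lf N M : (N <= M)%N -> logn p N`! = (\sum_(1 <= k < M.+1) N %/ p ^ k)%N.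
  move=> NM; rewrite logn_fact // [RHS](@big_cat_nat _ _ _ N.+1) //=.
  rewrite [X in (_ + X)%N]big_nat_cond [X in (_ + X)%N]big1 ?addn0 // => k /andP[/andP[Nk _] _].
  by rewrite divn_small // (leq_trans Nk) // ltnW // ltn_expl // prime_gt1.
have ff : (f <= f * 2)%N by rewrite leq_pmulr.
have := bin_fact ff; rewrite (_ : f * 2 - f = f)%N; last by lia.
move/(congr1 (logn p)); rewrite !lognM ?muln_gt0 ?fact_gt0 ?bin_gt0 //.
rewrite (lf _ _ ff) (lf _ _ (leqnn _)).
under [in RHS]eq_bigr do rewrite dbl.
rewrite -big_distrl /= => H; rewrite -{1}(expn1 p) pfactor_dvdn ?bin_gt0 //; lia.
Qed.

(* [Z = T_0 + T_4], [Y = T_1 + T_5] and [A = T_2] for the octic periods [T_i] when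
   Frobenius, i.e. i -> 3i, identifies [T_3 = T_1], [T_6 = T_2] and [T_7 = T_5]. *)
Lemma octic_periods_3mod8 (K : numFieldType) (Z Y A N f : K) (s : nat) :
  Z + 2%:R * Y + 2%:R * A = -1 -> (Z + 2%:R * A) * Y = - f ->
  2%:R * A * Z + Y ^+ 2 = - f -> A ^+ 2 = N ->
  64%:R * N = 7%:R * s%:R ^+ 2 + 1 -> 8%:R * f = s%:R ^+ 2 - 1 ->
  (s <= 3)%N.
Proof.
move=> h1 hY hA hN h64 h8.
have ZE : Z = -1 - 2%:R * Y - 2%:R * A by rewrite -h1; ring.
have fE : f = - ((Z + 2%:R * A) * Y) by rewrite hY opprK.
(* Both [4 Y + 1] and [2 A - Z] turn out to be s or -s, and they determine 8A. For each choice of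
   signs, (8A)^2 = 7 s^2 + 1 becomes linear in s after division by s > 0; only 2s = 6 has a
   solution. *)
have Y2 : (4%:R * Y + 1) ^+ 2 == s%:R ^+ 2.
  have -> : s%:R ^+ 2 = 8%:R * f + 1 by rewrite h8 subrK.
  by apply/eqP; rewrite fE ZE; ring.
have A2 : (2%:R * A - Z) ^+ 2 == s%:R ^+ 2.
  have -> : s%:R ^+ 2 = 8%:R * f + 1 by rewrite h8 subrK.
  have -> : 8%:R * f = 4%:R * f - 4%:R * (2%:R * A * Z + Y ^+ 2) by rewrite hA; ring.
  by apply/eqP; rewrite fE ZE; ring.
have AE : 8%:R * A = 2%:R * (2%:R * A - Z) - (4%:R * Y + 1) - 1 by rewrite ZE; ring.
have : (8%:R * A) ^+ 2 = 7%:R * s%:R ^+ 2 + 1 by rewrite -h64 -hN; ring.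
rewrite AE; have [->//|s0] := posnP s.
have s0K : (s%:R : K) != 0 by rewrite pnatr_eq0 -lt0n.
have fin (a b c d : nat) (x : K) :
    x = 0 -> x = s%:R * ((a * s + b)%:R - (c * s + d)%:R) ->
    (a * s + b = c * s + d)%N.
  move=> x0 xE; move: x0; rewrite xE => /eqP.
  by rewrite mulf_eq0 (negbTE s0K) subr_eq0 eqr_nat => /eqP.
rewrite !eqf_sqr in Y2 A2.
case/orP: Y2 => /eqP->; case/orP: A2 => /eqP-> /eqP; rewrite -subr_eq0 => /eqP H.
- by have := fin 0%N 0%N 6%N 2%N _ H; rewrite !natrD !natrM => /(_ ltac:(ring)); lia.
- by have := fin 2%N 6%N 0%N 0%N _ H; rewrite !natrD !natrM => /(_ ltac:(ring)); lia.
- by have := fin 2%N 0%N 0%N 6%N _ H; rewrite !natrD !natrM => /(_ ltac:(ring)); lia.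
by have := fin 0%N 2%N 6%N 0%N _ H; rewrite !natrD !natrM => /(_ ltac:(ring)); lia.
Qed.

(** * Additive characters of a finite field *)

Section AdditiveCharacters.
Variable F : finFieldType.

(** Nontrivial characters of (F, +); the conjugation clause records that the values lie on the unit
    circle. *)
Definition additive_char (psi : F -> algC) : Prop :=
  [/\ psi 0 = 1, {morph psi : x y / x + y >-> x * y},
      forall x, psi (- x) = (psi x)^* & exists x, psi x != 1].

Lemma additive_char_exists : exists psi, additive_char psi.
Proof.
pose G := [set: F]%G.
have abG : abelian G by apply/centsP=> x _ y _; exact: addrC.
have nG : (1 < Nirr G)%N.
  rewrite NirrE (eqP (etrans (esym (card_classes_abelian _)) abG)) cardsT.
  exact: finNzRing_gt1.
(* Index 0 is the trivial character, so index 1 is a nontrivial one. *)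
pose i : Iirr G := Ordinal nG.
have lin : 'chi_i \is a linear_char by apply/char_abelianP.
exists 'chi_i; split=> [|x y|x|].
- exact: (lin_char1 lin).
- exact: (lin_charM lin (in_setT x) (in_setT y)).
- exact: (lin_charV_conj lin (in_setT x)).
apply/existsP; apply: contraT; rewrite negb_exists => /forallP H.
have /eqP : 'chi_i = 1 by apply/cfunP=> x; rewrite cfun1E in_setT; apply/eqP; rewrite -[_ == _]negbK.
by rewrite irr_eq1.
Qed.

Lemma additive_char_sum0 psi : additive_char psi -> \sum_x psi x = 0.
Proof.
case=> _ psiD _ [a na].
have : (psi a - 1) * \sum_x psi x = 0.
  rewrite mulrBl mul1r mulr_sumr [in X in _ - X](reindex_inj (addrI a)) /=.
  by under eq_bigr do rewrite -psiD; rewrite subrr.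
by move/eqP; rewrite mulf_eq0 subr_eq0 (negbTE na) => /eqP.
Qed.

Lemma additive_char_scale psi b :
  b != 0 -> additive_char psi -> additive_char (fun x => psi (b * x)).
Proof.
move=> b0 [p0 pD pN [x px]]; split=> [|y z|y|].
- by rewrite mulr0.
- by rewrite mulrDr pD.
- by rewrite mulrN pN.
by exists (x / b); rewrite mulrC divfK.
Qed.

(** Fourier inversion: the double sum of h(x) psi(b(x - y)) over b and x equals q h(y) by
    orthogonality in b, and only its term b = 0, which does not depend on y, survives the
    hypothesis. *)
Lemma fourier_constant psi (h : F -> algC) :
  additive_char psi ->
  (forall b, b != 0 -> \sum_x h x * psi (b * x) = 0) ->
  forall x y, h x = h y.
Proof.
move=> hpsi h0.
have q0 : (#|F|%:R : algC) != 0 by rewrite pnatr_eq0 -lt0n; apply/card_gt0P; exists 0.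
have [p0 pD _ _] := hpsi.
suff hE y : #|F|%:R * h y = \sum_x h x.
  by move=> x y; apply: (mulfI q0); rewrite !hE.
transitivity (\sum_b \sum_x h x * psi (b * (x - y))).
  rewrite exchange_big (bigD1 y) //= subrr [X in _ + X]big1 => [|x nxy].
    under eq_bigr do rewrite mulr0 p0 mulr1.
    by rewrite sumr_const addr0 mulr_natl.
  rewrite -mulr_sumr.
  under eq_bigr do rewrite mulrC.
  by rewrite (additive_char_sum0 (additive_char_scale _ hpsi)) ?mulr0 // subr_eq0.
rewrite (bigD1 0) //= [X in _ + X]big1 => [|b nb].
  by rewrite addr0; apply: eq_bigr => x _; rewrite mul0r p0 mulr1.
under eq_bigr do rewrite mulrBr pD mulrA.
by rewrite -mulr_suml h0 ?mul0r.
Qed.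

(* Composing any character with the absolute trace makes it Frobenius-invariant. *)
Lemma frobenius_invariant_char p n :
  prime p -> #|F| = (p ^ n)%N ->
  exists2 psi, additive_char psi & forall x, psi (x ^+ p) = psi x.
Proof.
move=> pr_p cardF.
have n0 : (0 < n)%N.
  by rewrite lt0n; apply: contraTneq (finNzRing_gt1 F) => n0; rewrite cardF n0.
have chp : p \in [pchar F] by apply: (card_finPcharP (n := n)).
pose Tr (x : F) := \sum_(i < n) x ^+ (p ^ i).
have TrD : {morph Tr : x y / x + y}.
  move=> x y; rewrite /Tr -big_split /=; apply: eq_bigr => i _.
  by rewrite exprDn_pchar // pnatX (pnatE _ pr_p) chp.
have TrN x : Tr (- x) = - Tr x.
  apply/eqP; rewrite -addr_eq0 -TrD addNr /Tr big1 // => i _.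
  by rewrite expr0n expn_eq0 eqn0Ngt prime_gt0.
have TrX x : Tr (x ^+ p) = Tr x.
  rewrite /Tr -(prednK n0) big_ord_recr [RHS]big_ord_recl /= addrC.
  rewrite -exprM -expnS prednK // -cardF expf_card expn0 expr1; congr (_ + _).
  by apply: eq_bigr => i _; rewrite -exprM -expnS.
have [y Ty] : exists y, Tr y != 0.
  apply/existsP; apply: contraT; rewrite negb_exists => /forallP H.
  (* If the trace vanished identically, this nonzero polynomial of degree less than p^n would have
     all p^n elements of F as roots. *)
  pose P : {poly F} := \sum_(i < n) 'X^(p ^ i).
  have P0 : P != 0.
    apply/eqP => /(congr1 (fun Q : {poly F} => Q`_1)); rewrite coef_sum coef0.
    rewrite (bigD1 (Ordinal n0)) //= coefXn expn0 eqxx big1 ?addr0 => [/eqP|i ni].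
      by rewrite oner_eq0.
    rewrite coefXn (_ : (1 == p ^ i)%N = false) //; apply/negbTE.
    by rewrite eq_sym -(expn0 p) eqn_exp2l ?prime_gt1.
  have : all (root P) (enum F).
    apply/allP => x _; rewrite /root horner_sum.
    under eq_bigr do rewrite hornerXn.
    by rewrite -[_ == _]negbK H.
  move/(max_poly_roots P0) => /(_ (enum_uniq F)); rewrite -cardE.
  rewrite ltnNge (leq_trans (size_sum _ _ _)) //; apply/bigmax_leqP => i _.
  by rewrite size_polyXn cardF ltn_exp2l // prime_gt1.
have [psi0 [p0 pD pN [z pz]]] := additive_char_exists.
(* The factor [z / Tr y] makes the argument at y equal to z, where [psi0] is not 1. *)
exists (fun x => psi0 (z / Tr y * Tr x)) => [|x]; last by rewrite TrX.
split=> [|a b|a|].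
- by rewrite -[in Tr 0](subrr (0 : F)) TrD TrN subrr mulr0.
- by rewrite TrD mulrDr pD.
- by rewrite TrN mulrN pN.
by exists y; rewrite divfK.
Qed.

End AdditiveCharacters.

(** * Cyclotomic classes *)

Lemma sum_differences (G : finZmodType) (R : pzRingType) (A B : {set G})
    (g : G -> R) :
  \sum_(x in A) \sum_(y in B) g (x - y) = \sum_d (Delta2 A B d)%:R * g d.
Proof.
rewrite pair_big /= (partition_big (fun z : G * G => z.1 - z.2) xpredT) //=.
apply: eq_bigr => d _; rewrite /Delta2 ffunE.
rewrite (eq_bigr (fun=> g d)) => [|z /andP[_ /eqP->]//].
rewrite sumr_const mulr_natl; congr (_ *+ _); apply: eq_card => z.
by rewrite !inE.
Qed.

Lemma Delta_neq0 (G : finZmodType) (A : {set G}) d :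
  d != 0 -> Delta A d = Delta2 A A d.
Proof.
move=> d0; rewrite !ffunE; apply: eq_card => z; rewrite !inE.
have [/= zd|] := eqVneq (z.1 - z.2) d; last by rewrite !andbF.
by rewrite -subr_eq0 zd d0.
Qed.

Lemma Delta_at0 (G : finZmodType) (A : {set G}) : Delta A 0 = 0%N.
Proof.
rewrite ffunE; apply/eqP; rewrite cards_eq0; apply/eqP/setP => z.
by rewrite !inE subr_eq0 andNb andbF.
Qed.

Lemma Delta2_at0 (G : finZmodType) (A B : {set G}) :
  Delta2 A B 0 = #|A :&: B|.
Proof.
rewrite ffunE -(card_imset _ (f := fun x : G => (x, x))) => [|x y []//].
apply: eq_card => -[x y]; rewrite !inE /= subr_eq0.
apply/idP/imsetP => [/andP[/andP[xA yB] /eqP xy]|[z zAB [-> ->]]].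
  by exists x; rewrite ?inE ?xA xy.
by move: zAB; rewrite inE eqxx andbT.
Qed.

Lemma Delta2_opp (G : finZmodType) (A B : {set G}) d :
  Delta2 A B (- d) = Delta2 B A d.
Proof.
rewrite !ffunE -(card_imset _ (f := fun z : G * G => (z.2, z.1))) => [|[a b] [c d'] [-> ->]//].
apply: eq_card => -[x y]; rewrite !inE /=; apply/imsetP/idP => [[[a b]]|].
  rewrite !inE /= => /andP[/andP[aA bB] /eqP abd] [-> ->]; rewrite aA bB /=.
  by rewrite -opprB abd opprK.
move=> /andP[/andP[xB yA] /eqP xyd]; exists (y, x); rewrite // !inE /= xB yA /=.
by rewrite -opprB xyd.
Qed.

Section CyclotomicClasses.
Variables (F : finFieldType) (alpha : F) (e f : nat).
Hypotheses (e_gt0 : (0 < e)%N) (f_gt0 : (0 < f)%N).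
Hypothesis cardF : #|F| = (e * f).+1.
Hypothesis alpha_prim : (e * f)%N.-primitive_root alpha.

Local Notation C := (cyclotomic_class alpha e).
Local Notation w := (alpha ^+ f).

Lemma exp_order (x : F) : x != 0 -> x ^+ (e * f) = 1.
Proof.
move=> x0; apply: (mulfI x0); rewrite -exprS -cardF mulr1; exact: expf_card.
Qed.

Lemma alpha_neq0 : alpha != 0.
Proof.
apply/eqP => a0; have := prim_expr_order alpha_prim; rewrite a0 expr0n.
by rewrite muln_eq0 !eqn0Ngt e_gt0 f_gt0 => /eqP; rewrite eq_sym oner_eq0.
Qed.

Lemma root_prim : e.-primitive_root w.
Proof. by have := dvdn_prim_root alpha_prim (dvdn_mulr f (dvdnn e)); rewrite mulKn. Qed.

(** A power residue test: x^f is constant on each class, and for x = alpha^n it equals w^n, which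
    determines n modulo e because w is a primitive e-th root of unity. *)
Lemma mem_class i x : (x \in C i) = (x ^+ f == w ^+ i).
Proof.
apply/imsetP/eqP => [[j _ ->]|xf].
  rewrite exprMn -!exprM (mulnC i) (mulnAC e) exprM (exprM alpha (e * f)).
  by rewrite (prim_expr_order alpha_prim) expr1n mulr1 -exprM.
have x0 : x != 0.
  apply: contra_eq_neq xf => ->; rewrite expr0n eqn0Ngt f_gt0 eq_sym.
  by rewrite !expf_neq0 ?alpha_neq0.
have [n xn] : exists n, x = alpha ^+ n.
  by have [n ->] := prim_rootP alpha_prim (exp_order x0); exists n.
have /eqP ni : n == i %[mod e].
  by rewrite -(eq_prim_root_expr root_prim) -xf xn -!exprM mulnC.
(* Adding a multiple of the order of alpha keeps the subtraction N - i from being truncated. *)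
pose N := (n + i * (e * f))%N.
have iN : (i <= N)%N by rewrite /N (leq_trans _ (leq_addl _ _)) // leq_pmulr // muln_gt0 e_gt0.
have eN : (e %| N - i)%N.
  rewrite -eqn_mod_dvd // /N; apply/eqP.
  by rewrite mulnCA (mulnC e (i * f)) addnC modnMDl.
(* The definition of a class bounds the exponent, so it is reduced modulo f. *)
have ae : (alpha ^+ e) ^+ f = 1 by rewrite -exprM (prim_expr_order alpha_prim).
have jlt : ((N - i) %/ e %% f < #|F|)%N.
  by rewrite cardF ltnS ltnW // (leq_trans (ltn_pmod _ f_gt0)) ?leq_pmull.
exists (Ordinal jlt) => //=; rewrite (expr_mod _ ae) -exprM mulnC divnK // -exprD.
rewrite subnKC // /N exprD (mulnC i) exprM (prim_expr_order alpha_prim).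
by rewrite expr1n mulr1.
Qed.

Lemma class_neq0 i x : x \in C i -> x != 0.
Proof.
rewrite mem_class; apply: contraTneq => ->.
by rewrite expr0n eqn0Ngt f_gt0 eq_sym !expf_neq0 ?alpha_neq0.
Qed.

Lemma class_cover x : x != 0 -> {i : 'I_e | x \in C i}.
Proof.
move=> x0; have /(prim_rootP root_prim)[i xi] : (x ^+ f) ^+ e = 1.
  by rewrite -exprM mulnC exp_order.
by exists i; rewrite mem_class xi.
Qed.

Lemma class_eq_mod i j x : x \in C i -> (x \in C j) = (i == j %[mod e]).
Proof. by rewrite !mem_class => /eqP->; rewrite (eq_prim_root_expr root_prim). Qed.

Lemma class_uniq (i j : 'I_e) x : x \in C i -> (x \in C j) = (i == j).
Proof. by move/class_eq_mod->; rewrite !modn_small. Qed.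

Lemma mem_class_scale i j x : (alpha ^+ i * x \in C (i + j)) = (x \in C j).
Proof.
rewrite !mem_class exprMn (exprAC alpha i f) exprD.
by rewrite (inj_eq (mulfI (expf_neq0 i (expf_neq0 f alpha_neq0)))).
Qed.

Lemma sum_class (V : nmodType) i (g : F -> V) :
  \sum_(x in C i) g x = \sum_(x in C 0) g (alpha ^+ i * x).
Proof.
rewrite (reindex_inj (mulfI (expf_neq0 i alpha_neq0))) /=.
by apply: eq_bigl => x; rewrite -{2}(addn0 i) mem_class_scale.
Qed.

Lemma sum_units (V : nmodType) (g : F -> V) :
  \sum_(x | x != 0) g x = \sum_(i < e) \sum_(x in C i) g x.
Proof.
rewrite (exchange_big_dep (fun x => x != 0)) /= => [|i x _]; last exact: class_neq0.
apply: eq_bigr => x x0; have [i xi] := class_cover x0.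
by rewrite (big_pred1 i) // => j; rewrite /= (class_uniq _ xi) eq_sym.
Qed.

Lemma card_class i : #|C i| = f.
Proof.
have cC j : #|C j| = #|C 0| by rewrite -!sum1_card sum_class.
have := sum_units (fun=> 1%N); rewrite sum1_card cardC1 cardF /=.
under eq_bigr do rewrite sum1_card cC.
by rewrite sum_nat_const card_ord => /eqP; rewrite eqn_pmul2l // cC => /eqP.
Qed.

Lemma class0E x : (x \in C 0) = (x ^+ f == 1).
Proof. by rewrite mem_class expr0. Qed.

Lemma class0M c x : c \in C 0 -> (c * x \in C 0) = (x \in C 0).
Proof. by rewrite !class0E exprMn => /eqP->; rewrite mul1r. Qed.

Lemma sum_class_invariant (V : nmodType) (g : F -> V) :
  (forall c x, c \in C 0 -> g (x * c) = g x) ->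
  \sum_(x | x != 0) g x = (\sum_(i < e) g (alpha ^+ i)) *+ f.
Proof.
move=> gC; rewrite sum_units -sumrMnl; apply: eq_bigr => i _.
rewrite sum_class (eq_bigr (fun=> g (alpha ^+ i))) => [|x xC]; last exact: gC.
by rewrite sumr_const card_class.
Qed.

Lemma class_inj : injective (fun i : 'I_e => C i).
Proof.
move=> i j Cij; have aC : alpha ^+ i \in C i by rewrite mem_class exprAC.
by apply/eqP; rewrite -(class_uniq _ aC) -Cij.
Qed.

Lemma mem_class_div i j d : (d / alpha ^+ i \in C j) = (d \in C (i + j)).
Proof.
by rewrite -(mem_class_scale i) mulrC divfK // expf_neq0 ?alpha_neq0.
Qed.

Lemma Delta2_class i d :
  Delta2 (C i) (C i) d = Delta2 (C 0) (C 0) (d / alpha ^+ i).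
Proof.
have a0 : alpha ^+ i != 0 by rewrite expf_neq0 ?alpha_neq0.
rewrite !ffunE -[RHS](card_imset _ (f := fun x : F * F => (alpha ^+ i * x.1, alpha ^+ i * x.2))).
  apply: eq_card => -[x y]; rewrite !inE /=.
  apply/idP/imsetP => [/andP[/andP[xC yC] /eqP xyd]|[[x' y']]].
    exists (x / alpha ^+ i, y / alpha ^+ i) => /=; last by rewrite !(mulrC (alpha ^+ i)) !divfK.
    by rewrite !inE /= !mem_class_div addn0 xC yC -mulrBl xyd eqxx.
  rewrite !inE /= => /andP[/andP[xC yC] /eqP xyd] [-> ->].
  have scE v : (alpha ^+ i * v \in C i) = (v \in C 0).
    by rewrite -[in RHS](mem_class_scale i) addn0.
  by rewrite !scE xC yC -mulrBr xyd mulrC divfK /=.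
by move=> [a b] [c d'] /= [] /(mulfI a0)-> /(mulfI a0)->.
Qed.

Lemma mem_cover_classes (I : {set 'I_e}) (k : 'I_e) d :
  d \in C k -> (d \in cover [set C i | i : 'I_e in I]) = (k \in I).
Proof.
move=> dk; rewrite /cover; apply/bigcupP/idP => [[_ /imsetP[i iI ->]]|kI].
  by rewrite (class_uniq _ dk) => /eqP->.
by exists (C k); rewrite // imset_f.
Qed.

Lemma copies_cover (I : {set 'I_e}) a b d :
  (copies a (cover [set C i | i : 'I_e in I])
   + copies b (Gstar F :\: cover [set C i | i : 'I_e in I])) d =
  if d == 0 then 0%N else
  if d \in cover [set C i | i : 'I_e in I] then a else b.
Proof.
rewrite !ffunE inE; have [->|d0] := eqVneq d 0.
  rewrite !inE eqxx andbF addr0; case: ifP => // /bigcupP[_ /imsetP[i _ ->]].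
  by move/class_neq0; rewrite eqxx.
by rewrite !inE d0 andbT; case: (d \in _); rewrite /= ?addr0 ?add0r.
Qed.

(** C_0 is the group of f-th roots of unity. If f does not divide k, multiplying the sum by
    (alpha^e)^k, which is not 1, only permutes its terms. *)
Lemma power_sum_class0 k :
  \sum_(x in C 0) x ^+ k = if (f %| k)%N then f%:R else 0.
Proof.
have [/dvdnP[j ->]|fk] := ifPn.
  rewrite (eq_bigr (fun=> 1)) => [|x]; first by rewrite sumr_const card_class.
  by rewrite class0E mulnC exprM => /eqP->; rewrite expr1n.
have zC : alpha ^+ e \in C 0.
  by rewrite class0E -exprM (prim_expr_order alpha_prim).
have zk : (alpha ^+ e) ^+ k != 1.
  by rewrite -exprM -(prim_order_dvd alpha_prim) dvdn_pmul2l.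
apply/eqP; rewrite -(mulrI_eq0 _ (_ : GRing.lreg ((alpha ^+ e) ^+ k - 1))); last first.
  by apply/lregP; rewrite subr_eq0.
rewrite mulrBl mul1r mulr_sumr subr_eq0; apply/eqP.
rewrite [RHS](reindex_inj (mulfI (expf_neq0 e alpha_neq0))) /=.
by apply: eq_big => [x|x _]; rewrite ?class0M // exprMn.
Qed.

Lemma power_sum_units k :
  ~~ (e * f %| k)%N -> \sum_(x : F | x != 0) x ^+ k = 0.
Proof.
rewrite (prim_order_dvd alpha_prim) => ak.
apply/eqP; rewrite -(mulrI_eq0 _ (_ : GRing.lreg (alpha ^+ k - 1))); last first.
  by apply/lregP; rewrite subr_eq0.
rewrite mulrBl mul1r mulr_sumr subr_eq0; apply/eqP.
rewrite [RHS](reindex_inj (mulfI alpha_neq0)) /=.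
by apply: eq_big => [x|x _]; rewrite ?mulf_eq0 ?(negbTE alpha_neq0) // exprMn.
Qed.

Lemma sum_multiples (V : nmodType) t (h : nat -> V) :
  \sum_(i < (f * t).+1 | (f %| i)%N) h i = \sum_(j < t.+1) h (f * j)%N.
Proof.
have lt1 (j : 'I_t.+1) : (f * j < (f * t).+1)%N by rewrite ltnS leq_pmul2l // -ltnS ltn_ord.
have lt2 (i : 'I_(f * t).+1) : (i %/ f < t.+1)%N.
  by rewrite ltn_divLR // (leq_trans (ltn_ord i)) // mulSn mulnC -add1n leq_add2r.
rewrite (reindex_onto (fun j => Ordinal (lt1 j)) (fun i => Ordinal (lt2 i))) /=.
  by apply: eq_bigl => j; rewrite dvdn_mulr // -val_eqE /= mulKn ?eqxx.
by move=> i fi; apply: val_inj; rewrite /= mulnC divnK.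
Qed.

(** In the binomial expansion only the exponents divisible by f have a nonzero power sum over
    C_0. *)
Lemma power_sum_differences t :
  \sum_(x in C 0) \sum_(y in C 0) (x - y) ^+ (f * t) =
  \sum_(i < t.+1) (-1) ^+ (f * i) * f%:R ^+ 2 *+ 'C(f * t, f * i).
Proof.
under eq_bigr do (under eq_bigr do rewrite exprBn; rewrite exchange_big /=).
rewrite exchange_big /= -(sum_multiples _ (fun i => (-1) ^+ i * f%:R ^+ 2 *+ 'C(f * t, i))).
rewrite [RHS]big_mkcond /=; apply: eq_bigr => i _.
transitivity ((-1) ^+ i * (\sum_(x in C 0) x ^+ (f * t - i)) *
              (\sum_(y in C 0) y ^+ i) *+ 'C(f * t, i)).
  rewrite -mulrA big_distrlr mulr_sumr -sumrMnl; apply: eq_bigr => x _.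
  by rewrite mulr_sumr -sumrMnl; apply: eq_bigr => y _; rewrite mulrA.
rewrite !power_sum_class0; have [fi|] := boolP (f %| i)%N; last by rewrite mulr0 mul0rn.
by rewrite dvdn_subr ?dvdn_mulr // ?fi ?expr2 ?mulrA //; rewrite -ltnS.
Qed.

(** * Gaussian periods *)

Section GaussianPeriods.
Variable psi : F -> algC.
Hypothesis psi_char : additive_char psi.

Definition period (c : F) : algC := \sum_(x in C 0) psi (c * x).

Lemma period_mulC0 c z : z \in C 0 -> period (c * z) = period c.
Proof.
move=> zC; rewrite /period [RHS](reindex_inj (mulfI (class_neq0 zC))) /=.
by apply: eq_big => [x|x _]; rewrite ?class0M // mulrA.
Qed.

Lemma period_class i c b :
  c \in C i -> period (b * c) = period (b * alpha ^+ i).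
Proof.
move=> cC; have zC : c / alpha ^+ i \in C 0.
  by rewrite -(mem_class_scale i) addn0 mulrC divfK // expf_neq0 ?alpha_neq0.
rewrite -(period_mulC0 (b * alpha ^+ i) zC) -mulrA (mulrC (alpha ^+ i)) divfK //.
by rewrite expf_neq0 ?alpha_neq0.
Qed.

Lemma class_period i b : \sum_(x in C i) psi (b * x) = period (b * alpha ^+ i).
Proof. by rewrite sum_class; apply: eq_bigr => x _; rewrite mulrA. Qed.

Lemma sum_units_char c : c != 0 -> \sum_(x | x != 0) psi (c * x) = -1.
Proof.
move=> c0; apply/eqP; rewrite -addr_eq0 addrC; apply/eqP.
have := additive_char_sum0 (additive_char_scale c0 psi_char).
by rewrite (bigD1 0) //= mulr0; case: psi_char => ->.
Qed.

Lemma sum_periods c : c != 0 -> \sum_(i < e) period (c * alpha ^+ i) = -1.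
Proof.
move=> c0; rewrite -(sum_units_char c0) sum_units.
by apply: eq_bigr => i _; rewrite class_period.
Qed.

Lemma period_conj c : (period c)^* = period (- c).
Proof.
rewrite /period rmorph_sum; apply: eq_bigr => x _ /=.
by case: psi_char => _ _ pN _; rewrite mulNr pN.
Qed.

Lemma periodM c d :
  period c * period d = \sum_(x in C 0) \sum_(y in C 0) psi (c * x + d * y).
Proof.
rewrite /period mulr_suml; apply: eq_bigr => x _; rewrite mulr_sumr.
by apply: eq_bigr => y _; case: psi_char => _ ->.
Qed.

Lemma period0 : period 0 = f%:R.
Proof.
rewrite /period (eq_bigr (fun=> 1)) ?sumr_const ?card_class // => x _.
by rewrite mul0r; case: psi_char.
Qed.

(** Multiply by f and extend the sum to all c in F, the term c = 0 being f^2. Summing psi(c(x + gy))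
    over c gives q when x = -gy and 0 otherwise, and this has solutions in C_0, one for each x,
    exactly when -g lies in C_0. *)
Lemma period_correlation g : g != 0 ->
  \sum_(i < e) period (alpha ^+ i) * period (alpha ^+ i * g) =
  (if - g \in C 0 then #|F|%:R else 0) - f%:R.
Proof.
move=> g0; have f0 : (f%:R : algC) != 0 by rewrite pnatr_eq0 -lt0n.
apply: (mulfI f0).
rewrite mulr_natl -(sum_class_invariant (g := fun c => period c * period (c * g))); last first.
  by move=> z c zC; rewrite (mulrAC c z) !(period_mulC0 _ zC).
transitivity (\sum_c period c * period (c * g) - f%:R ^+ 2).
  by rewrite [in RHS](bigD1 0) //= mul0r period0 expr2 addrAC subrr add0r.
rewrite mulrBr -expr2; congr (_ - _).
under eq_bigr do rewrite periodM.
rewrite exchange_big /= (eq_bigr (fun=> if - g \in C 0 then #|F|%:R else 0)).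
  by rewrite sumr_const card_class mulr_natl.
move=> x xC; rewrite exchange_big /=.
rewrite (eq_bigr (fun y => if y == - (x / g) then #|F|%:R else 0)); last first.
  move=> y _; under eq_bigr do rewrite -mulrA -mulrDr mulrC.
  have [->|yx] := eqVneq.
    rewrite mulrN mulrC divfK // subrr.
    under eq_bigr do rewrite mul0r.
    by case: psi_char => -> _ _ _; rewrite sumr_const.
  apply: (additive_char_sum0 (additive_char_scale _ psi_char)).
  apply: contraNneq yx => /eqP; rewrite addr_eq0 => /eqP->.
  by rewrite mulNr opprK mulrC mulKf.
rewrite -big_mkcondr /=; case: ifP => gC.
  rewrite (big_pred1 (- (x / g))) // => y /=; have [->|] := eqVneq; last by rewrite andbF.
  rewrite -mulrN -invrN; rewrite class0M // andbT.
  by move: gC; rewrite !class0E exprVn => /eqP->; rewrite invr1 eqxx.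
apply: big1 => y /andP[yC /eqP yx]; move: yC; rewrite yx -mulrN -invrN class0M //.
rewrite class0E exprVn invr_eq1 -class0E gC.
by [].
Qed.

Lemma period_frobenius p c :
  p \in [pchar F] -> (forall x, psi (x ^+ p) = psi x) ->
  period (c ^+ p) = period c.
Proof.
move=> chp psiX; have injX : injective (fun x : F => x ^+ p).
  exact: (fmorph_inj (pFrobenius_aut chp)).
rewrite /period (reindex_inj injX) /=; apply: eq_big => [x|x _].
  by rewrite !class0E exprAC -{1}(expr1n _ p) (inj_eq injX).
by rewrite -exprMn psiX.
Qed.

End GaussianPeriods.

(** * The case where C_0 is a partial difference set *)

Section PartialDifferenceSet.
Variables l mu : nat.
Hypothesis pds : Delta (C 0) = copies l (C 0) + copies mu (Gstar F :\: C 0).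

Lemma pds_count d :
  Delta2 (C 0) (C 0) d = if d == 0 then f else if d \in C 0 then l else mu.
Proof.
have [->|d0] := eqVneq d 0; first by rewrite Delta2_at0 setIid card_class.
rewrite -Delta_neq0 // pds !ffunE !inE d0 andbT.
by case: (d \in C 0); rewrite /= ?addr0 ?add0r.
Qed.

(** The ring is arbitrary because the identity serves for counting over the integers, for power sums
    in F and for characters in [algC]. *)
Lemma pds_sum (R : pzRingType) (g : F -> R) :
  \sum_(x in C 0) \sum_(y in C 0) g (x - y) =
  f%:R * g 0 + (l%:R - mu%:R) * (\sum_(x in C 0) g x)
    + mu%:R * \sum_(x | x != 0) g x.
Proof.
rewrite sum_differences (bigD1 0) //= pds_count eqxx -addrA; congr (_ + _).
rewrite !(bigID (fun x => x \in C 0) (fun x => x != 0)) /=.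
have E : \sum_(x | (x != 0) && (x \in C 0)) g x = \sum_(x in C 0) g x.
  apply: eq_bigl => x; rewrite andbC; by have [/class_neq0->|] := boolP (x \in C 0).
rewrite !E mulrDr addrA -mulrDl subrK; congr (_ + _).
  rewrite -E mulr_sumr; apply: eq_bigr => x /andP[x0 xC].
  by rewrite pds_count (negbTE x0) xC.
rewrite mulr_sumr; apply: eq_bigr => x /andP[x0 xC].
by rewrite pds_count (negbTE x0) (negbTE xC).
Qed.

(** The count f(f - 1) = l f + mu(ef - f) of all differences, divided by f. *)
Lemma pds_parameters : (f + mu = 1 + l + e * mu)%N.
Proof.
have := @pds_sum int (fun=> 1); rewrite !sumr_const cardC1 cardF /= card_class.
have f0 : (f%:R : int) != 0 by rewrite pnatr_eq0 -lt0n.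
move=> E; apply/eqP; rewrite -(eqr_nat int) !natrD natrM.
have {}E : f%:R = 1 + (l%:R - mu%:R) + mu%:R * e%:R :> int.
  by apply: (mulfI f0); move: E; rewrite -mulrnA !natrM mulr1 => ->; ring.
by apply/eqP; rewrite E; ring.
Qed.

(** For 0 < k < e the power sum of exponent fk over all units vanishes, so the sum of (x - y)^(fk)
    over C_0 is (l - mu) f in F. It equals 2 f^2 for k = 1 and (2 + binomial(2f, f)) f^2 for k =
    2. *)
Lemma pds_dvd_bin p n :
  prime p -> #|F| = (p ^ n)%N -> (2 < e)%N -> ~~ odd f ->
  (p %| 'C(f * 2, f))%N.
Proof.
move=> pr_p cardFp e2 f_even; have chp := card_finPcharP cardFp pr_p.
have f0 : (f%:R : F) != 0.
  rewrite -(dvdn_pcharf chp); apply/negP => pf.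
  have : (p %| (e * f).+1)%N.
    rewrite -cardF cardFp dvdn_exp // lt0n.
    by apply: contraTneq (finNzRing_gt1 F) => n0; rewrite cardFp n0.
  by rewrite -addn1 dvdn_addr ?dvdn_mull // Euclid_dvd1.
have key k : (0 < k < e)%N ->
    \sum_(i < k.+1) f%:R ^+ 2 *+ 'C(f * k, f * i) =
    (l%:R - mu%:R) * f%:R :> F.
  case/andP=> k0 ke.
  transitivity (\sum_(x in C 0) \sum_(y in C 0) (x - y) ^+ (f * k)).
    rewrite power_sum_differences; apply: eq_bigr => i _.
    by rewrite -signr_odd oddM (negbTE f_even) mul1r.
  rewrite (pds_sum (fun x => x ^+ (f * k))).
  rewrite power_sum_class0 dvdn_mulr // power_sum_units ?mulr0 ?addr0.
    by rewrite expr0n muln_eq0 !eqn0Ngt f_gt0 k0 mulr0 add0r.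
  by rewrite (mulnC f) dvdn_pmul2r // gtnNdvd.
have := key 2%N e2; rewrite -(key 1%N (ltnW e2)) !big_ord_recr !big_ord0 /=.
rewrite !muln0 !muln1 !bin0 !binn !mulr1n add0r addrAC => /eqP.
rewrite -[X in _ == X]addr0 (inj_eq (addrI _)) -mulr_natr mulf_eq0 expf_eq0 (negbTE f0).
by rewrite (dvdn_pcharf chp).
Qed.

Section PdsPeriods.
Variable psi : F -> algC.
Hypothesis psi_char : additive_char psi.
Local Notation T := (period psi).

Lemma pds_period c : c != 0 ->
  T c * T (- c) = f%:R + (l%:R - mu%:R) * T c - mu%:R.
Proof.
move=> c0; rewrite (periodM psi_char).
transitivity (\sum_(x in C 0) \sum_(y in C 0) psi (c * (x - y))).
  by apply: eq_bigr => x _; apply: eq_bigr => y _; rewrite mulNr mulrBr.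
rewrite (pds_sum (fun d => psi (c * d))) (sum_units_char psi_char c0) mulrN1.
by rewrite mulr0; case: psi_char => -> _ _ _; rewrite mulr1.
Qed.

Lemma pds_period_sym c : -1 \in C 0 -> c != 0 ->
  T c ^+ 2 = f%:R + (l%:R - mu%:R) * T c - mu%:R.
Proof.
by move=> sC c0; rewrite -pds_period // -mulrN1 period_mulC0.
Qed.

(** Put b = l - mu and let r be a square root of the discriminant, so that each 2T - b is r or -r.
    If r occurs a times, summing over the e periods gives -2 - eb = (2a - e) r, which is then
    squared. *)
Lemma pds_multiplicity : -1 \in C 0 ->
  exists2 a, (a <= e)%N &
    (e%:R * (l%:R - mu%:R) + 2%:R) ^+ 2 =
    (2%:R * a%:R - e%:R) ^+ 2 * ((l%:R - mu%:R) ^+ 2 + 4%:R * (f%:R - mu%:R)) :> int.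
Proof.
move=> sC; pose b : algC := l%:R - mu%:R.
pose D : algC := b ^+ 2 + 4%:R * (f%:R - mu%:R).
pose r := sqrtC D.
have TE (i : 'I_e) :
    2%:R * T (1 * alpha ^+ i) - b = (2%:R * (2%:R * T (1 * alpha ^+ i) - b == r)%:R - 1) * r.
  set t := T _; have : (2%:R * t - b) ^+ 2 == r ^+ 2.
    rewrite sqrtCK /D /b.
    have := pds_period_sym sC (expf_neq0 i alpha_neq0); rewrite -[alpha ^+ i]mul1r -/t.
    by move=> tE; apply/eqP; ring: tE.
  rewrite eqf_sqr; have [->|_] /= := eqVneq; first by rewrite mulr1 mulr2n addrK mul1r.
  by move/eqP->; rewrite mulr0 sub0r mulN1r.
pose a := (\sum_(i < e) (2%:R * T (1 * alpha ^+ i)%R - b == r)%R)%N.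
exists a.
  by rewrite -[leqRHS]card_ord -sum1_card leq_sum // => i _; case: (_ == _).
apply: (@intr_inj algC).
rewrite !(rmorphXn, rmorphM, rmorph_nat, rmorphB, rmorphD) /= -/b -/D -[D]sqrtCK -/r.
rewrite -exprMn.
have := sum_periods psi_char (oner_neq0 F).
have : \sum_(i < e) (2%:R * T (1 * alpha ^+ i) - b) = (2%:R * a%:R - e%:R) * r.
  rewrite (eq_bigr _ (fun i _ => TE i)) -mulr_suml big_split /= -mulr_sumr.
  by rewrite sumr_const card_ord -mulNrn natr_sum.
rewrite big_split /= -mulr_sumr => <- ->; rewrite sumr_const card_ord -mulr_natl; ring.
Qed.

End PdsPeriods.
(** By contradiction, through the octic periods t_0, ..., t_7. Conjugation acts on them as i -> i +
    4 and Frobenius as i -> pi; the surviving case q = 9 has f = 1. *)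
Lemma pds_symmetric p m :
  e \in [:: 3; 4; 6; 8]%N -> prime p -> #|F| = (p ^ (2 * m))%N -> (1 < f)%N ->
  -1 \in C 0.
Proof.
move=> he pr_p cardFp f1; apply: contraT => sC.
have chp := card_finPcharP cardFp pr_p.
have f_odd : odd f.
  by apply: contraNT sC => fe; rewrite class0E -signr_odd (negbTE fe).
have p_odd : odd p.
  have [p2|//] := even_prime pr_p; case/negP: sC; rewrite p2 in chp.
  by rewrite class0E (oppr_pchar2 chp) expr1n.
pose s := (p ^ m)%N.
have s_odd : odd s by rewrite oddX p_odd orbT.
have sE : (s * s = e * f + 1)%N by rewrite addn1 -cardF cardFp mulnC expnM.
(* The odd square s^2 is 1 modulo 8, so 8 divides ef; as f is odd, 8 divides e. *)
have e8 : e = 8%N.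
  have sk := odd_double_half s; have fh := odd_double_half f.
  rewrite s_odd in sk; rewrite f_odd in fh.
  have xx := odd_double_half (s./2 * s./2.+1).
  rewrite oddM /= andbN add0n in xx.
  have sE' : (e * f = 4 * (s./2 * s./2.+1))%N by nia.
  move: he; rewrite !inE => /or4P[] /eqP ee //; rewrite {1}ee -xx in sE'; lia.
(* Negation preserves the differences of C_0, but 1 lies in C_0 and occurs l times while -1 lies
   outside and occurs mu times. *)
have lmu : l = mu.
  have := Delta2_opp (C 0) (C 0) 1; rewrite !pds_count oppr_eq0 oner_eq0 (negbTE sC).
  by rewrite class0E expr1n eqxx.
have w4 : w ^+ 4 = -1.
  have : (w ^+ 4) ^+ 2 == 1 by rewrite -exprM (_ : 4 * 2 = e)%N ?e8 // -e8 (prim_expr_order root_prim).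
  rewrite sqrf_eq1 => /orP[|/eqP//].
  by rewrite -(prim_order_dvd root_prim) e8.
have N1 : -1 \in C 4 by rewrite mem_class w4 -signr_odd f_odd.
have [psi psi_char psiX] := frobenius_invariant_char pr_p cardFp.
pose t i := period psi (alpha ^+ i).
have t8 i : t (i + 8)%N = t i.
  rewrite /t exprD period_mulC0 // class0E -exprM -{1}e8.
  by rewrite (prim_expr_order alpha_prim).
have tmod i : t i = t (i %% 8)%N.
  rewrite {1}(divn_eq i 8) addnC; elim: (i %/ 8)%N => [|k IHk]; first by rewrite addn0.
  by rewrite mulSn addnCA addnC t8.
have tconj i : (t i)^* = t (i + 4)%N.
  by rewrite /t (period_conj psi_char) -mulrN1 (period_class _ _ N1) exprD.
have tN i : t i * t (i + 4)%N = f%:R - mu%:R.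
  rewrite -tconj /t (period_conj psi_char) (pds_period psi_char) ?expf_neq0 ?alpha_neq0 //.
  by rewrite lmu subrr mul0r addr0.
have tsum : \sum_(i < 8) t i = -1.
  rewrite -(sum_periods psi_char (oner_neq0 F)) e8.
  by apply: eq_bigr => i _; rewrite mul1r.
have tcorr j : (j %% 8 != 4)%N -> \sum_(i < 8) t i * t (i + j)%N = - f%:R.
  move=> j4; have := period_correlation psi_char (expf_neq0 j alpha_neq0).
  rewrite class0E exprNn -signr_odd f_odd expr1 mulN1r eqr_oppLR exprAC -w4.
  rewrite (eq_prim_root_expr root_prim) e8 (negbTE j4) sub0r => <-.
  by apply: eq_bigr => i _; rewrite /t exprD.
have tfrob i : t (i * p)%N = t i by rewrite /t exprM (period_frobenius _ chp psiX).
(* If p were 1 or 7 modulo 8, then p^2 and hence q would be 1 modulo 16, making f even. *)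
have p8 : (p %% 8 == 3)%N || (p %% 8 == 5)%N.
  apply: contraTT f_odd => p8.
  have p16 : (p ^ 2 = 1 %[mod 16])%N.
    have := divn_eq p 8; have : (p %% 8 < 8)%N by rewrite ltn_mod.
    move: p_odd p8; rewrite {1}(divn_eq p 8) oddD oddM andbF /=.
    move: (p %/ 8)%N (p %% 8)%N => k r; do 8?[case: r => [|r] //] => _ _ _ ->.
      by rewrite (_ : _ ^ 2 = (4 * k * k + k) * 16 + 1)%N ?modnMDl //; nia.
    by rewrite (_ : _ ^ 2 = (4 * k * k + 7 * k + 3) * 16 + 1)%N ?modnMDl //; nia.
  have : (#|F| = 1 %[mod 16])%N by rewrite cardFp expnM -modnXm p16 modnXm exp1n.
  rewrite cardF {1}e8 => /eqP; rewrite eqn_mod_dvd // subn1 /=.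
  by rewrite -[16%N]/(8 * 2)%N dvdn_pmul2l // dvdn2.
have tp i : t (i * (p %% 8))%N = t i by rewrite tmod modnMmr -tmod.
(* Conjugation exchanges t_i and t_(i+4), so their sum is real. *)
have tpos (i : nat) : 0 <= (t i + t (i + 4)%N) ^+ 2.
  suff E : (t i + t (i + 4)%N)^* = t i + t (i + 4)%N by rewrite expr2 -{2}E mul_conjC_ge0.
  by rewrite rmorphD /= !tconj -addnA t8 addrC.
have fE : (f = 1 + 8 * mu)%N by have := pds_parameters; rewrite lmu e8; lia.
have corr j : (j %% 8 != 4)%N -> t 0%N * t j + t 1%N * t ((1 + j) %% 8)%N +
    t 2%N * t ((2 + j) %% 8)%N + t 3%N * t ((3 + j) %% 8)%N + t 4%N * t ((4 + j) %% 8)%N +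
    t 5%N * t ((5 + j) %% 8)%N + t 6%N * t ((6 + j) %% 8)%N + t 7%N * t ((7 + j) %% 8)%N = - f%:R.
  move=> j4; rewrite -(tcorr j j4) !big_ord_recr big_ord0 /= add0r.
  by rewrite -!tmod.
have sum8 : t 0%N + t 1%N + t 2%N + t 3%N + t 4%N + t 5%N + t 6%N + t 7%N = -1.
  by rewrite -tsum !big_ord_recr big_ord0 /= add0r.
have N04 : t 0%N * t 4%N = f%:R - mu%:R := tN 0%N.
have N15 : t 1%N * t 5%N = f%:R - mu%:R := tN 1%N.
have N26 : t 2%N * t 6%N = f%:R - mu%:R := tN 2%N.
have N37 : t 3%N * t 7%N = f%:R - mu%:R := tN 3%N.
case/orP: p8 => /eqP p8; rewrite p8 in tp.
  (* For p = 3 modulo 8 the correlations at shifts 1 and 2 give s <= 3, against f > 1. *)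
  have t3 : t 3%N = t 1%N := tp 1%N; have t6 : t 6%N = t 2%N := tp 2%N.
  have t7 : t 7%N = t 5%N by rewrite -(tp 5%N) [RHS]tmod.
  have c1 : t 0%N * t 1%N + t 1%N * t 2%N + t 2%N * t 3%N + t 3%N * t 4%N + t 4%N * t 5%N +
    t 5%N * t 6%N + t 6%N * t 7%N + t 7%N * t 0%N = - f%:R := corr 1%N isT.
  have c2 : t 0%N * t 2%N + t 1%N * t 3%N + t 2%N * t 4%N + t 3%N * t 5%N + t 4%N * t 6%N +
    t 5%N * t 7%N + t 6%N * t 0%N + t 7%N * t 1%N = - f%:R := corr 2%N isT.
  rewrite t3 t6 t7 in sum8 c1 c2 N26.
  have s2 : (s%:R : algC) ^+ 2 = 8%:R * f%:R + 1.
    by rewrite -natrX -mulnn sE e8 natrD natrM.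
  have mE : (f%:R : algC) = 1 + 8%:R * mu%:R by rewrite {1}fE natrD natrM.
  have : (s <= 3)%N.
    apply: (@octic_periods_3mod8 algC (t 0%N + t 4%N) (t 1%N + t 5%N) (t 2%N)
             (f%:R - mu%:R) f%:R).
    - by rewrite -sum8; ring.
    - by rewrite -c1; ring.
    - by rewrite -c2; ring.
    - by rewrite -N26.
    - by rewrite s2 mE; ring.
    - by rewrite s2; ring.
  by move=> s3; move: sE; rewrite e8; nia.
(* For p = 5 modulo 8 the identifications t_5 = t_1 and t_7 = t_3 turn the correlation at shift 0
   into two squares of real numbers with the negative sum -f. *)
have t5 : t 5%N = t 1%N := tp 1%N.
have t7 : t 7%N = t 3%N by rewrite -(tp 3%N) [RHS]tmod.
have c0 : t 0%N * t 0%N + t 1%N * t 1%N + t 2%N * t 2%N + t 3%N * t 3%N + t 4%N * t 4%N + t 5%N * t 5%N +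
  t 6%N * t 6%N + t 7%N * t 7%N = - f%:R := corr 0%N isT.
rewrite t5 t7 in c0 N15 N37.
have E : (t 0%N + t 4%N) ^+ 2 + (t 2%N + t 6%N) ^+ 2 = - f%:R.
  transitivity (- f%:R + 2%:R * (t 0%N * t 4%N) + 2%:R * (t 2%N * t 6%N)
                - 2%:R * (t 1%N * t 1%N) - 2%:R * (t 3%N * t 3%N)).
    by rewrite -c0; ring.
  by rewrite N04 N15 N26 N37; ring.
by have := addr_ge0 (tpos 0%N) (tpos 2%N); rewrite E oppr_ge0 lern0 eqn0Ngt f_gt0.
Qed.

(** C_i is C_0 scaled by alpha^i, so a nonzero d occurs l times among the differences of C_i if it
    lies in C_i, and mu times otherwise. *)
Lemma pds_internal (I : {set 'I_e}) :
  (0 < #|I|)%N ->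
  \sum_(A in [set C i | i : 'I_e in I]) Delta A =
  copies (l + #|I|.-1 * mu) (cover [set C i | i : 'I_e in I])
  + copies (#|I| * mu) (Gstar F :\: cover [set C i | i : 'I_e in I]).
Proof.
move=> I0; apply/ffunP => d; rewrite big_imset /=; last exact: in2W class_inj.
rewrite sum_ffunE copies_cover; have [->|d0] := eqVneq d 0.
  by rewrite big1 // => i _; rewrite Delta_at0.
have [k dk] := class_cover d0; rewrite (mem_cover_classes _ dk).
rewrite (eq_bigr (fun i => if i == k then l else mu)) => [|i _]; last first.
  rewrite Delta_neq0 // Delta2_class pds_count mem_class_div addn0.
  by rewrite mulf_eq0 invr_eq0 expf_eq0 (negbTE alpha_neq0) andbF (negbTE d0) (class_uniq _ dk) eq_sym.
case: ifPn => kI.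
  rewrite (bigD1 k) //= eqxx; congr (_ + _)%N.
  rewrite (eq_bigr (fun=> mu)) => [|i /andP[_ /negbTE->]//].
  rewrite sum_nat_const (cardsD1 k I) kI /=; congr (_ * _)%N.
  by apply: eq_card => j; rewrite !inE andbC.
rewrite (eq_bigr (fun=> mu)) ?sum_nat_const // => i iI.
by rewrite (negbTE (_ : i != k)) //; apply: contraNneq kI => <-.
Qed.

(** The integer z is eta. If the sign eps were not (-1)^m, then p = 1 modulo e, and p would both
    divide and not divide binomial(2f, f). *)
Lemma pds_eta p m :
  e \in [:: 3; 4; 6; 8]%N -> prime p -> #|F| = (p ^ (2 * m))%N -> (1 < f)%N ->
  exists z : int, [/\ e%:R * z = (- p%:R) ^+ m - 1,
    l%:R - mu%:R = - ((e%:R - 2%:R) * z) - 1 & mu%:R = z ^+ 2 + z].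
Proof.
move=> he pr_p cardFp f1; have sC := pds_symmetric he pr_p cardFp f1.
have e2 : (2 < e)%N by move: he; rewrite !inE => /or4P[] /eqP->.
have [psi psi_char] := additive_char_exists F.
have [a ae aE] := pds_multiplicity psi_char sC.
have qE : (p ^ (2 * m) = e * f + 1)%N by rewrite -cardFp cardF addn1.
have sE : (p ^ m * p ^ m = e * f + 1)%N by rewrite -qE mulnC expnM mulnn.
have [eps [z [heps zE wE]]] := exists_period_sign he ae sE pds_parameters aE.
have epsE : eps = (-1) ^+ m.
  have [//|p1] := sign_exponent he pr_p f_gt0 qE heps zE.
  (* For odd f, -1 in C_0 means -1 = 1, so p = 2, which is not 1 modulo e > 2. *)
  have fe : ~~ odd f.
    apply/negP => fo; have : (p %| 2)%N.
      rewrite (dvdn_pcharf (card_finPcharP cardFp pr_p)) -[2%:R]/(1 + 1) addr_eq0 eq_sym.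
      by move: sC; rewrite class0E -signr_odd fo.
    rewrite dvdn_prime2 // => /eqP p2; move: p1; rewrite p2 !modn_small //.
    exact: ltnW.
  have := prime_ndvd_bin_repunit e2 pr_p p1 qE.
  by rewrite (pds_dvd_bin pr_p cardFp e2 fe).
have e0 : (e%:R : int) != 0 by rewrite pnatr_eq0 -lt0n.
have tE : eps * (p ^ m)%:R = e%:R * z + 1 by rewrite -zE subrK.
exists z; split.
- by rewrite -zE epsE natrX -exprMn mulN1r.
- apply: (mulfI e0); apply: (addIr 2%:R).
  by rewrite wE tE; ring.
have lE : l%:R - mu%:R = - ((e%:R - 2%:R) * z) - 1 :> int.
  by apply: (mulfI e0); apply: (addIr 2%:R); rewrite wE tE; ring.
(* The value of mu comes from (ez + 1)^2 = q = ef + 1 after expressing f by l - mu and mu; the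
   factor e^2 cancels. *)
apply: (mulfI e0); apply: (mulfI e0).
have fE : f%:R = 1 + (l%:R - mu%:R) + e%:R * mu%:R :> int.
  apply: (addIr mu%:R); rewrite -natrD pds_parameters !natrD natrM; ring.
have : (e%:R * z + 1) * (e%:R * z + 1) = e%:R * f%:R + 1 :> int.
  rewrite -tE mulrACA -[X in _ * X]natrM sE natrD natrM.
  by rewrite (_ : eps * eps = 1) ?mul1r //; case: heps => ->.
rewrite fE lE => H; apply: (addIr (e%:R * (1 + (- ((e%:R - 2%:R) * z) - 1)) + 1)).
transitivity (e%:R * (1 + (- ((e%:R - 2%:R) * z) - 1) + e%:R * mu%:R) + 1); first by ring.
by rewrite -H; ring.
Qed.

(** * Uniform periods and the cross differences of the classes *)

Section Uniform.
Variable z : int.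
Hypothesis sC : -1 \in C 0.
Hypothesis z_tau : e%:R * z + 1 != 0.
Hypothesis lE : l%:R - mu%:R = - ((e%:R - 2%:R) * z) - 1 :> int.
Hypothesis muE : mu%:R = z ^+ 2 + z :> int.

Section UniformPeriods.
Variable psi : F -> algC.
Hypothesis psi_char : additive_char psi.
Local Notation T := (period psi).
Local Notation zC := (z%:~R : algC).

(** With these parameters the quadratic of the periods factors as (T - z)(T + 1 + (e - 1) z). The
    second root is what the sum -1 leaves for one period when the other e - 1 equal z. *)
Lemma uniform_period c : c != 0 ->
  (T c == zC) || (T c == -1 - (e%:R - 1) * zC).
Proof.
move=> c0; rewrite -subr_eq0 -[X in _ || X]subr_eq0 -mulf_eq0.
have lC : l%:R - mu%:R = - ((e%:R - 2%:R) * zC) - 1.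
  have := congr1 (fun x : int => x%:~R : algC) lE.
  by rewrite !(rmorphXn, rmorphM, rmorph_nat, rmorphN, rmorphB, rmorphD) /=.
have mC : mu%:R = zC ^+ 2 + zC.
  have := congr1 (fun x : int => x%:~R : algC) muE.
  by rewrite !(rmorphXn, rmorphM, rmorph_nat, rmorphN, rmorphB, rmorphD) /=.
have fC : f%:R = 1 + (l%:R - mu%:R) + e%:R * mu%:R :> algC.
  by apply: (addIr mu%:R); rewrite -natrD pds_parameters !natrD natrM; ring.
have := pds_period_sym psi_char sC c0; rewrite fC lC mC => H; apply/eqP.
transitivity (T c ^+ 2 + (- ((e%:R - 1) * zC ^+ 2) - zC + (1 + (e%:R - 2%:R) * zC) * T c)).
  by ring.
by rewrite H; ring.
Qed.

(** Each factor is the value, at the character x -> psi(cx), of the indicator of a class minus z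
    times the indicator of 0. *)
Lemma uniform_orthogonal c (i j : 'I_e) : c != 0 -> i != j ->
  (T (c * alpha ^+ i) - zC) * (T (c * alpha ^+ j) - zC) = 0.
Proof.
move=> c0 ij; pose b (k : 'I_e) := T (c * alpha ^+ k) != zC.
have tau0 : - (e%:R * zC + 1) != 0.
  rewrite oppr_eq0; have := z_tau; rewrite -(intr_eq0 algC).
  by rewrite rmorphD rmorphM rmorph_nat /= rmorph1.
have TE (k : 'I_e) : T (c * alpha ^+ k) = zC - (b k)%:R * (e%:R * zC + 1).
  have := uniform_period (mulf_neq0 c0 (expf_neq0 k alpha_neq0)).
  by rewrite /b; case: eqP => [->|_ /= /eqP->]; rewrite ?mul0r ?subr0 //; ring.
(* The periods sum to -1, so exactly one of them differs from z. *)
have b1 : (\sum_k b k = 1)%N.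
  apply/eqP; rewrite -(eqr_nat algC); apply/eqP; apply: (mulIf tau0).
  apply: (addrI (e%:R * zC)).
  transitivity (-1 : algC); last by ring.
  rewrite -(sum_periods psi_char c0) (eq_bigr _ (fun k _ => TE k)) big_split /=.
  rewrite sumr_const card_ord mulr_natl natr_sum mulr_suml; congr (_ + _).
  by apply: eq_bigr => k _; rewrite mulrN.
rewrite !TE; case bi : (b i); last by rewrite mul0r subr0 subrr mul0r.
case bj : (b j); last by rewrite mul0r subr0 subrr mulr0.
by move: b1; rewrite (bigD1 i) //= (bigD1 j) 1?eq_sym //= bi bj.
Qed.

End UniformPeriods.

(** The convolution of C_i - z and C_j - z vanishes at every nontrivial character, hence is a
    constant function; its value at 0 is z^2 because the two classes are disjoint. *)
Lemma uniform_cross (i j : 'I_e) d : i != j -> d != 0 ->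
  (Delta2 (C i) (C j) d)%:R =
  z ^+ 2 + (if d \in C i then z else 0) + (if d \in C j then z else 0).
Proof.
move=> ij d0; have [psi psi_char] := additive_char_exists F.
(* This is the expanded convolution, with differences in place of sums since -1 lies in C_0. *)
pose h x : algC := (Delta2 (C i) (C j) x)%:R
  - ((x \in C i)%:R * z%:~R + (x \in C j)%:R * z%:~R - (x == 0)%:R * z%:~R ^+ 2).
have hc : h d = h 0.
  apply: (fourier_constant psi_char) => b b0.
  rewrite -[RHS](uniform_orthogonal psi_char b0 ij).
  have Sc k : \sum_x (x \in C k)%:R * z%:~R * psi (b * x) =
      z%:~R * period psi (b * alpha ^+ k).
    rewrite -class_period mulr_sumr [RHS]big_mkcond; apply: eq_bigr => x _ /=.
    by case: (x \in C k); rewrite ?mul1r // !mul0r.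
  have Sd : \sum_x (Delta2 (C i) (C j) x)%:R * psi (b * x) =
      period psi (b * alpha ^+ i) * period psi (b * alpha ^+ j).
    rewrite -(sum_differences _ _ (fun x => psi (b * x))).
    rewrite -(period_mulC0 _ (b * alpha ^+ j) sC) mulrN1 -mulNr -!class_period.
    rewrite mulr_suml; apply: eq_bigr => x _; rewrite mulr_sumr.
    by apply: eq_bigr => y _; case: psi_char => _ pD _ _; rewrite mulrBr pD mulNr.
  have S0 : \sum_x (x == 0)%:R * z%:~R ^+ 2 * psi (b * x) = z%:~R ^+ 2.
    rewrite (bigD1 0) //= big1 => [|x /negbTE->]; last by rewrite !mul0r.
    by case: psi_char => p0 _ _ _; rewrite mulr0 p0 eqxx mul1r mulr1 addr0.
  rewrite (eq_bigr (fun x => (Delta2 (C i) (C j) x)%:R * psi (b * x) -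
      ((x \in C i)%:R * z%:~R * psi (b * x) + (x \in C j)%:R * z%:~R * psi (b * x)
       - (x == 0)%:R * z%:~R ^+ 2 * psi (b * x)))); last by move=> x _; rewrite /h; ring.
  by rewrite sumrB Sd sumrB S0 big_split /= !Sc; ring.
apply: (@intr_inj algC); rewrite rmorph_nat.
have n0 k : (0 \in C k) = false by apply/negP => /class_neq0; rewrite eqxx.
have CiCj : C i :&: C j = set0.
  apply/setP => x; rewrite !inE; apply/negP => /andP[xi].
  by rewrite (class_uniq _ xi) (negbTE ij).
move: hc; rewrite /h (negbTE d0) eqxx Delta2_at0 CiCj cards0 !n0 => hc.
rewrite !rmorphD rmorphXn /=.
transitivity ((d \in C i)%:R * z%:~R + (d \in C j)%:R * z%:~R + z%:~R ^+ 2 : algC).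
  apply: (addIr (- ((d \in C i)%:R * z%:~R + (d \in C j)%:R * z%:~R - 0%:R * z%:~R ^+ 2))).
  by rewrite hc /=; ring.
by case: (d \in C i); case: (d \in C j) => /=; ring.
Qed.

Section Family.
Variable I : {set 'I_e}.
Local Notation D := [set C i | i : 'I_e in I].

(** The u(u - 1) ordered pairs of classes contribute z^2 each. If d lies in C_k with k in I, the u -
    1 pairs starting at k and the u - 1 pairs ending at k contribute a further z each. *)
Lemma uniform_external (a b : nat) :
  a%:R = #|I|%:R * (#|I|%:R - 1) * z ^+ 2 + 2%:R * (#|I|%:R - 1) * z ->
  b%:R = #|I|%:R * (#|I|%:R - 1) * z ^+ 2 ->
  \sum_(A in D) \sum_(B in D | A != B) Delta2 A B =
  copies a (cover D) + copies b (Gstar F :\: cover D).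
Proof.
move=> aE bE; apply/ffunP => d; rewrite big_imset /=; last exact: in2W class_inj.
rewrite sum_ffunE.
transitivity (\sum_(i in I) \sum_(j in I | i != j) Delta2 (C i) (C j) d)%N.
  apply: eq_bigr => i _; rewrite sum_ffunE big_imset_cond /=; last exact: in2W class_inj.
  by apply: eq_bigl => j; rewrite (inj_eq class_inj).
rewrite copies_cover; have [->|d0] := eqVneq d 0.
  rewrite big1 // => i _; rewrite big1 // => j /andP[_ ij]; rewrite Delta2_at0.
  apply/eqP; rewrite cards_eq0; apply/eqP/setP => x; rewrite !inE.
  by apply/negP => /andP[xi]; rewrite (class_uniq _ xi) (negbTE ij).
have [k dk] := class_cover d0.
rewrite (mem_cover_classes _ dk).
apply/eqP; rewrite -(eqr_nat int) natr_sum; apply/eqP.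
transitivity (\sum_(i in I) \sum_(j in I | i != j)
    (z ^+ 2 + (if i == k then z else 0) + (if j == k then z else 0))).
  apply: eq_bigr => i _; rewrite natr_sum; apply: eq_bigr => j /andP[_ ij].
  by rewrite uniform_cross // !(class_uniq _ dk) ![k == _]eq_sym.
have cI i : i \in I -> #|[pred j in I | i != j]|%:R = #|I|%:R - 1 :> int.
  move=> iI; rewrite (cardsD1 i I) iI add1n -natr1 addrK.
  by congr _%:R; apply: eq_card => j; rewrite !inE eq_sym andbC.
transitivity (\sum_(i in I) ((#|I|%:R - 1) * (z ^+ 2 + (if i == k then z else 0))
    + (if (k \in I) && (i != k) then z else 0))).
  apply: eq_bigr => i iI; rewrite big_split /= sumr_const -(cI i iI) mulr_natl.
  congr (_ + _); rewrite -big_mkcondr /=; case: ifP => [/andP[kI ik]|].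
    by rewrite (big_pred1 k) // => j /=; have [->|] := eqVneq j k; rewrite ?andbF // kI ik.
  move=> h; rewrite big_pred0 // => j; have [->|] := eqVneq j k; rewrite ?andbF //.
  by rewrite andbT.
rewrite big_split /= -mulr_sumr big_split /= sumr_const -[z ^+ 2 *+ _]mulr_natl -!big_mkcondr /=.
case: ifPn => kI /=.
  rewrite (big_pred1 k) => [|i /=]; last by have [->|] := eqVneq i k; rewrite ?kI ?andbF.
  rewrite (eq_bigl [in [pred j in I | k != j]]) => [|i]; last first.
    by rewrite !inE eq_sym.
  rewrite sumr_const aE.
  by rewrite -[z *+ _]mulr_natl cI //; ring.
have -> : \sum_(i in I | i == k) z = 0.
  rewrite big_pred0 // => i; have [->|] := eqVneq i k; rewrite ?andbF //.
  by rewrite (negbTE kI).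
by rewrite big_pred0 => [|i]; rewrite ?andbF // bE; ring.
Qed.

End Family.

End Uniform.
End PartialDifferenceSet.
End CyclotomicClasses.

(** * The two families and their parameters *)

Theorem theorem4p7 (F : finFieldType) (alpha : F) (q e f p m u : nat)
  (I : {set 'I_e})
  (hF : #|F| = q)
  (halpha : (q - 1)%N.-primitive_root alpha)
  (hq : q = (e * f + 1)%N)
  (he : e \in [:: 3; 4; 6; 8]%N)
  (hf : (1 < f)%N)
  (hp : prime p)
  (hqp : q = (p ^ (2 * m))%N)
  (hI : #|I| = u)
  (hu : (2 <= u <= e - 1)%N) :
  let C := cyclotomic_class alpha e in
  let D' := [set C i | i : 'I_e in I] in
  let k := ((q - 1) %/ e)%N in
  let eta : rat := ((- p%:R) ^+ m - 1) / e%:R in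
  (exists lambda mu : rat, partial_difference_set q k lambda mu (C 0%N)) ->
  [/\ partial_difference_set q k
        (eta ^+ 2 - (e%:R - 3%:R) * eta - 1) (eta ^+ 2 + eta) (C 0%N),
      proper_disjoint_pdf q u k
        (u%:R * eta ^+ 2 + (u%:R + 2%:R - e%:R) * eta - 1)
        (u%:R * (eta ^+ 2 + eta)) D'
    & proper_external_pdf q u k
        (u%:R * (u%:R - 1) * eta ^+ 2 + 2%:R * (u%:R - 1) * eta)
        (u%:R * (u%:R - 1) * eta ^+ 2) D'].
Proof.
move=> C D' k eta [lam [mu0 [_ _ [l [mu [_ _ pds]]]]]].
have e2 : (2 < e)%N by move: he; rewrite !inE => /or4P[] /eqP->.
have e0 : (0 < e)%N by apply: ltn_trans e2.
have f0 : (0 < f)%N by apply: ltn_trans hf.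
have cardF : #|F| = (e * f).+1 by rewrite hF hq addn1.
have cardFp : #|F| = (p ^ (2 * m))%N by rewrite hF.
have q1 : (q - 1 = e * f)%N by rewrite hq addnK.
have prim : (e * f)%N.-primitive_root alpha by rewrite -q1.
have kE : k = f by rewrite /k q1 mulKn.
have sC := pds_symmetric e0 f0 cardF prim pds he hp cardFp hf.
have [z [zE lE muE]] := pds_eta e0 f0 cardF prim pds he hp cardFp hf.
have tE : e%:R * z + 1 = (- p%:R) ^+ m by rewrite zE subrK.
have tau0 : e%:R * z + 1 != 0.
  by rewrite tE expf_neq0 // oppr_eq0 pnatr_eq0 -lt0n prime_gt0.
have t2 : (e%:R * z + 1) * (e%:R * z + 1) = e%:R * f%:R + 1 :> int.
  rewrite tE -expr2 -exprM mulnC exprM sqrrN -exprM -natrX -hqp hq.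
  by rewrite natrD natrM.
(* The external family is proper because its lambda - mu is 2(u - 1) z. *)
have z0 : z != 0.
  apply/eqP => zz; move: t2; rewrite zz mulr0 add0r mulr1 !natz; nia.
(* The disjoint family has lambda - mu = -((e - 2) z + 1). This vanishes only for e = 3 and z = -1,
   where q = (ez + 1)^2 = 4 gives f = 1. *)
have nz : (e%:R - 2%:R) * z + 1 != 0.
  apply/eqP => h; move: he h t2; rewrite !inE => /or4P[] /eqP->; rewrite ?natz;
    move: hf; clear; lia.
have etaE : eta = z%:~R.
  have eQ : (e%:R : rat) != 0 by rewrite pnatr_eq0 -lt0n.
  apply: (mulIf eQ); rewrite /eta divfK // mulrC.
  have := congr1 (fun x : int => x%:~R : rat) zE.
  by rewrite !(rmorphXn, rmorphM, rmorph_nat, rmorphN, rmorphB, rmorph1) /= => <-.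
have lQ : l%:R = eta ^+ 2 - (e%:R - 3%:R) * eta - 1 :> rat.
  have : l%:R = z ^+ 2 - (e%:R - 3%:R) * z - 1 :> int.
    by apply: (addIr (- mu%:R)); rewrite lE muE; ring.
  move/(congr1 (fun x : int => x%:~R : rat)); rewrite etaE.
  by rewrite !(rmorphXn, rmorphM, rmorph_nat, rmorphN, rmorphB, rmorph1) /=.
have muQ : mu%:R = eta ^+ 2 + eta :> rat.
  move/(congr1 (fun x : int => x%:~R : rat)): muE; rewrite etaE.
  by rewrite !(rmorphXn, rmorph_nat, rmorphD) /=.
have u2 : (1 < #|I|)%N by rewrite hI; case/andP: hu.
have fam : disjoint_subsets_family q u k D'.
  split=> //.
  - by rewrite card_imset //; exact: (class_inj e0 f0 cardF prim).
  - apply/trivIsetP => _ _ /imsetP[i _ ->] /imsetP[j _ ->] nij.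
    rewrite -setI_eq0; apply/eqP/setP => x; rewrite !inE; apply/negP => /andP[xi].
    rewrite (class_uniq e0 f0 cardF prim _ xi) => /eqP ij.
    by rewrite ij eqxx in nij.
  move=> _ /imsetP[i _ ->]; split; last by rewrite kE (card_class e0 f0 cardF prim).
  by apply/subsetP => x /(class_neq0 e0 f0 cardF prim) x0; rewrite !inE.
have uE : (#|I|.-1)%:R = u%:R - 1 :> rat.
  by rewrite -hI -{2}(prednK (ltnW u2)) -natr1 addrK.
split.
- by split=> //; [rewrite kE (card_class e0 f0 cardF prim)|exists l, mu].
- split; last first.
    have : - ((e%:R - 2%:R) * eta + 1) != 0.
      rewrite oppr_eq0 etaE; have := nz; rewrite -(intr_eq0 rat).
      by rewrite !(rmorphM, rmorph_nat, rmorphB, rmorphD) /=.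
    by apply: contraNneq => h; apply/eqP; rewrite -(subrr (u%:R * (eta ^+ 2 + eta))) -{1}h; ring.
  split=> //; exists (l + #|I|.-1 * mu)%N, (#|I| * mu)%N; split.
  + by rewrite natrD natrM uE lQ muQ; ring.
  + by rewrite natrM muQ hI.
  exact: (pds_internal e0 f0 cardF prim pds (ltnW u2)).
have u1 : (u%:R - 1 : rat) != 0 by rewrite -uE pnatr_eq0 -lt0n -ltnS prednK // ltnW.
split; last first.
  rewrite -subr_eq0 [X in X != _]addrAC subrr add0r etaE.
  by rewrite !mulf_neq0 // intr_eq0.
pose a : int := u%:R * (u%:R - 1) * z ^+ 2 + 2%:R * (u%:R - 1) * z.
pose b : int := u%:R * (u%:R - 1) * z ^+ 2.
have uZ : 2 <= u%:R :> int by rewrite (ler_nat _ 2) -hI.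
have u1Z : 0 <= u%:R - 1 :> int by rewrite subr_ge0 (le_trans _ uZ).
(* The multiplicity must be a natural number: for z < 0 one has uz + 2 <= 2z + 2 <= 0, so z(uz + 2)
   is nonnegative. *)
have a0 : 0 <= a.
  have -> : a = (u%:R - 1) * (z * (u%:R * z + 2%:R)) by rewrite /a; ring.
  rewrite mulr_ge0 //; have [zp|zn] := leP 0 z; first by rewrite mulr_ge0 ?addr_ge0 ?mulr_ge0.
  rewrite mulr_le0 //; first exact: ltW.
  rewrite (le_trans (lerD (ler_wnM2r (ltW zn) uZ) (lexx _))) //; move: zn; clear; lia.
have b0 : 0 <= b by rewrite /b mulr_ge0 ?sqr_ge0 // mulr_ge0.
split=> //; exists (absz a), (absz b); split.
- rewrite natr_absz ger0_norm // etaE /a.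
  by rewrite !(rmorphXn, rmorphM, rmorph_nat, rmorphB, rmorph1, rmorphD) /=.
- rewrite natr_absz ger0_norm // etaE /b.
  by rewrite !(rmorphXn, rmorphM, rmorph_nat, rmorphB, rmorph1, rmorphD) /=.
apply: (uniform_external e0 f0 cardF prim pds sC tau0 lE muE); rewrite natz gez0_abs ?hI //.
Qed.
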